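(* Let $n$ be an odd positive integer and let $p$ be an odd prime. Then there are infinitely many quadruples of imaginary quadratic fields $$\left(\mathbb{Q}(\sqrt{d}),\ \mathbb{Q}(\sqrt{d+1}),\ \mathbb{Q}(\sqrt{d+4}),\ \mathbb{Q}(\sqrt{d+4p^2})\right),$$ with $d\in\mathbb{Z}$, such that the class number of each of these four fields is divisible by $n$.
   Context: For a nonzero integer $m$ that is not a perfect square, $\mathbb{Q}(\sqrt{m})$ denotes the quadratic field obtained by adjoining a square root of $m$; it is imaginary quadratic when $m<0$. The class number of a number field is the order of its ideal class group. *)

(* Defs.v *)
From mathcomp Require Export all_boot all_order all_algebra all_field.
From mathcomp Require Export boolp classical_sets functions cardinality.
Set Implicit Arguments.
Unset Strict Implicit.
Unset Printing Implicit Defensive.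
Import Order.TTheory GRing.Theory Num.Theory.
Local Open Scope classical_set_scope.
Local Open Scope ring_scope.

(* Number fields are realized as subfields of algC, so that equality of fields *)
(* is equality of sets. The field Q(a) is the smallest subfield containing a   *)
(* (every subfield of algC contains the rationals).                            *)
Definition Qadjoin (a : algC) : set algC :=
  [set x | forall S : {pred algC}, GRing.divring_closed S -> a \in S -> x \in S].

Definition Qsqrt (m : int) : set algC := Qadjoin (sqrtC m%:~R).

Definition ring_of_integers (K : set algC) : set algC :=
  [set x | K x /\ x \in Aint].

(* Nonzero fractional ideals of the ring of integers of K. *)
Record fractional_ideal (K I : set algC) : Prop := FractionalIdeal {
  fideal_sub : I `<=` K;
  fideal_0 : I 0;
  fideal_D : forall x y, I x -> I y -> I (x + y);
  fideal_M : forall r x, ring_of_integers K r -> I x -> I (r * x);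
  fideal_nz : exists2 x, I x & x != 0;
  fideal_denom : exists r, [/\ ring_of_integers K r, r != 0 &
                   forall x, I x -> ring_of_integers K (r * x)]
}.

Definition ideal_mul (I J : set algC) : set algC :=
  [set x | exists2 s : seq (algC * algC),
     forall u, u \in s -> I u.1 /\ J u.2 & x = \sum_(u <- s) u.1 * u.2].

Definition principal_ideal (K : set algC) (c : algC) : set algC :=
  [set c * r | r in ring_of_integers K].

(* The coset of I modulo the subgroup of nonzero principal fractional ideals. *)
Definition ideal_class (K I : set algC) : set (set algC) :=
  [set ideal_mul I (principal_ideal K c) | c in [set c | K c /\ c != 0]].

(* Underlying set of the ideal class group: the quotient of the group of       *)
(* fractional ideals by the principal ones.                                    *)
Definition class_group (K : set algC) : set (set (set algC)) :=
  [set ideal_class K I | I in [set I | fractional_ideal K I]].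

(* Relational, so that it includes the finiteness of the class group. *)
Definition has_class_number (K : set algC) (h : nat) : Prop :=
  (class_group K #= `I_h)%card.

Definition class_number_divisible_by (K : set algC) (n : nat) : Prop :=
  exists2 h, has_class_number K h & (n %| h)%N.

(* Main.v *)
From mathcomp Require Import zify ring lra.
Require Import Defs.
Set Implicit Arguments.
Unset Strict Implicit.
Unset Printing Implicit Defensive.
Import Order.TTheory GRing.Theory Num.Theory.
Local Open Scope classical_set_scope.
Local Open Scope ring_scope.

(** Take d = - m^n with m = 4 y^n - 9 p^2 and y = 1 mod 6p large. Each of the
    four fields contains a root alpha of X^2 - T X + Y^n with T prime to Y:
    (T, Y) = (3p, y), (2, m), (4, m), (4p, m). The ideal (Y, alpha) has n-th
    power (alpha), and multiplication by it permutes the class group. If its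
    k-th power (k a proper divisor of n) fixed a class, then alpha would be,
    up to a unit (which is 1 or -1), an (n/k)-th power beta^j with j >= 3 odd;
    then u = Tr beta divides T and T = u^j modulo Y, so T = u^j as Y is large,
    contradicting the factorisation of T. So all orbits on the class group have
    size n, and n divides the class number. Applying this to large odd
    multiples of n makes the class numbers unbounded, hence infinitely many
    quadruples occur. Finiteness of the class groups is Hurwitz's argument. *)

(** * Counting with a map all of whose orbits have the same size *)

(** Since [iter n f] is the identity, [f] is injective and the order of every point divides [n]. No
    proper divisor is possible, so every cycle has length [n] and [#|T|] is [n] times the number of
    cycles. *)
Lemma dvdn_card_orbits (T : finType) (f : T -> T) (n : nat) : (0 < n)%N ->
  (forall x, iter n f x = x) ->
  (forall x k, (k %| n)%N -> (k < n)%N -> iter k f x <> x) -> (n %| #|T|)%N.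
Proof.
move=> n_gt0 fn fk.
have f_inj : injective f.
  by move=> x y fxy; rewrite -(fn x) -(fn y) -(prednK n_gt0) !iterSr fxy.
have f_order x : order f x = n.
  have ox : iter (order f x) f x = x by rewrite iter_order.
  have oxM q : iter (q * order f x) f x = x.
    by elim: q => [//|q IHq]; rewrite mulSn iterD IHq ox.
  have o_dvd : (order f x %| n)%N.
    (* The remainder of [n] modulo the order also returns [x] to itself; being smaller than the
       order, it is 0. *)
    have := fn x; rewrite {1}(divn_eq n (order f x)) addnC iterD oxM => fr.
    have lt := ltn_pmod n (order_gt0 f x).
    by have := findex_iter lt; rewrite fr findex0 /dvdn => <-.
  apply/eqP; rewrite eqn_leq dvdn_leq //= leqNgt; apply/negP => lt.
  exact: (fk x _ o_dvd lt).
have /= <- := @fcard_order_set _ f f_inj n T; first exact: dvdn_mull.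
  by apply/fintype.subsetP => x _; rewrite inE f_order.
by move=> x y _; rewrite !inE.
Qed.

(** The bijection [phi] from ['I_h] conjugates [f] to a map [g] on a finite type, where the orbit
    count applies. *)
Lemma dvdn_card_eq_orbits (T : pointedType) (A : set T) (f : T -> T) (h n : nat) :
  (A #= `I_h)%card -> (0 < n)%N -> (forall x, A x -> A (f x)) ->
  (forall x, A x -> iter n f x = x) ->
  (forall x k, A x -> (k %| n)%N -> (k < n)%N -> iter k f x <> x) -> (n %| h)%N.
Proof.
move=> Ah n_gt0 fA fn fk.
have : ([set: 'I_h] #= A)%card.
  by apply: card_esym; apply: card_eq_trans Ah card_II.
move=> /card_set_bijP[phi [phi_fun phi_injT phi_surjT]].
have phiA i : A (phi i) by exact: phi_fun.
have phi_inj : injective phi.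
  by move=> i j; apply: phi_injT; rewrite in_setT.
have phi_surj x : A x -> exists i, phi i = x by move=> /phi_surjT[i _ <-]; exists i.
have /boolp.choice[g phig] i : exists j, phi j = f (phi i) by exact/phi_surj/fA.
have phi_iter k i : phi (iter k g i) = iter k f (phi i).
  by elim: k => [//|k IHk] /=; rewrite phig IHk.
rewrite -(card_ord h); apply: (dvdn_card_orbits (f := g)) => // [i|i k kn k_lt].
  by apply: phi_inj; rewrite phi_iter fn.
by move=> /(congr1 phi); rewrite phi_iter; apply: fk.
Qed.

(** * Squares, denominators and Lucas sequences *)

Lemma square_ratio_nat (E a b : nat) :
  (0 < a)%N -> (a ^ 2 * E = b ^ 2)%N -> exists c, E = (c ^ 2)%N.
Proof.
move=> a_gt0 eqab.
have /dvdnP[c bc] : (a %| b)%N by rewrite -(@dvdn_pexp2r _ _ 2) // -eqab dvdn_mulr.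
exists c; apply/eqP; rewrite -(@eqn_pmul2l (a ^ 2)) ?expn_gt0 ?a_gt0 //.
by rewrite eqab bc expnMn mulnC.
Qed.

Lemma square_ratio_rat (E : nat) (q : rat) :
  E%:R = q ^+ 2 -> exists c, E = (c ^ 2)%N.
Proof.
move=> Eq; apply: (@square_ratio_nat _ `|denq q|%N `|numq q|%N).
  by rewrite absz_gt0 denq_eq0.
apply/eqP; rewrite -(eqr_nat rat) natrM !natrX Eq !natr_absz !intr_norm.
rewrite !real_normK ?num_real //.
have d0 : (denq q)%:~R != 0 :> rat by rewrite intr_eq0 denq_eq0.
by rewrite -exprMn mulrC -[X in X * _]divq_num_den mulfVK.
Qed.

(** The case [k = 0] makes [M] an integer [m]. Every power of the denominator of [q] then divides
    [m], which bounds these powers and forces the denominator to be 1. *)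
Lemma bounded_denominator_int (M q : rat) : M != 0 ->
  (forall k, M * q ^+ k \is a Num.int) -> q \is a Num.int.
Proof.
move=> M0 Mq.
have /intrP[m Mm] : M \is a Num.int by have := Mq 0%N; rewrite expr0 mulr1.
have m0 : m != 0 by move: M0; rewrite Mm intr_eq0.
have dvd k : (`|denq q| ^ k %| `|m|)%N.
  have /intrP[z] := Mq k; rewrite Mm -[X in X ^+ k](divq_num_den q) expr_div_n.
  have d0 : (denq q)%:~R ^+ k != 0 :> rat by rewrite expf_neq0 // intr_eq0 denq_eq0.
  rewrite mulrA => /(canRL (mulfVK d0)) eqR.
  have /(congr1 absz) : m * numq q ^+ k = z * denq q ^+ k.
    by apply/eqP; rewrite -(eqr_int rat) !intrM !rmorphXn /= eqR.
  rewrite !abszM !abszX => eqm.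
  have : (`|denq q| ^ k %| `|m| * `|numq q| ^ k)%N by rewrite eqm dvdn_mull.
  by rewrite Gauss_dvdl // coprimeXl // coprimeXr // coprime_sym coprime_num_den.
have den_gt0 : (0 < `|denq q|)%N by rewrite absz_gt0 denq_eq0.
have den1 : `|denq q|%N = 1%N.
  case: (ltngtP `|denq q|%N 1%N) => // [|d_gt1]; first by lia.
  have := dvdn_leq _ (dvd `|m|%N); rewrite absz_gt0 m0 => /(_ isT).
  by rewrite leqNgt ltn_expl.
by rewrite Qint_def -absz_denq den1.
Qed.

(* Dirichlet approximation by pigeonhole on an L x L grid of fractional parts. *)
Lemma simultaneous_approximation (L : nat) (a b : rat) : (0 < L)%N ->
  exists t (u v : int), [/\ (0 < t <= L * L)%N,
    `|t%:R * a - u%:~R| < L%:R^-1 & `|t%:R * b - v%:~R| < L%:R^-1].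
Proof.
move=> L_gt0; have LR : 0 < L%:R :> rat by rewrite ltr0n.
(* The index of the interval of length [1/L] that contains the fractional part of [x]. *)
pose cell (x : rat) : int := Num.floor (L%:R * (x - (Num.floor x)%:~R)).
have cell_itv x : 0 <= cell x < L%:Z.
  have /andP[f1 f2] := floor_itv x.
  apply/andP; split.
    by rewrite /cell floor_ge0 mulr_ge0 ?(ltW LR) // subr_ge0.
  rewrite /cell -(@ltr_int rat) (le_lt_trans (floor_le _)) //.
  by move: f2; rewrite intrD; nra.
have cell_close x y : cell x = cell y ->
    `|(y - x) - (Num.floor y - Num.floor x)%:~R| < L%:R^-1.
  rewrite /cell => exy.
  have /andP[] := floor_itv (L%:R * (x - (Num.floor x)%:~R)).
  have /andP[] := floor_itv (L%:R * (y - (Num.floor y)%:~R)).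
  rewrite exy !intrD /= intrN => A B C D.
  rewrite -(ltr_pM2l LR) divff ?gt_eqF // -{1}(gtr0_norm LR) -normrM ltr_norml.
  by apply/andP; split; lra.
(* There are [L * L + 1] multiples for [L * L] pairs of cells. The successor form [L.-1.+1] of [L]
   is what [inord] requires. *)
pose g (t : 'I_(L * L).+1) : 'I_L.-1.+1 * 'I_L.-1.+1 :=
  (inord `|cell (t%:R * a)%R|%N, inord `|cell (t%:R * b)%R|%N).
have /injectivePn[s [t st gst]] : ~~ injectiveb g.
  apply/negP => /injectiveP /leq_card; rewrite card_prod !card_ord.
  by rewrite prednK // ltnn.
wlog lt_st : s t st gst / (s < t)%N.
  move=> W; case: (ltngtP s t) => [|lt|eq]; first exact: W.
    by apply: (W t s) => //; rewrite eq_sym.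
  by case/negP: st; apply/eqP/val_inj.
have cell_eq (c : rat) :
    inord `|cell (s%:R * c)%R|%N = inord `|cell (t%:R * c)%R|%N :> 'I_L.-1.+1 ->
    cell (s%:R * c) = cell (t%:R * c).
  move=> /(congr1 val) /=.
  have := cell_itv (s%:R * c); have := cell_itv (t%:R * c).
  by move=> h1 h2; rewrite !inordK ?prednK //; lia.
case: gst => /cell_eq/cell_close ca /cell_eq/cell_close cb.
exists (t - s)%N, (Num.floor (t%:R * a) - Num.floor (s%:R * a)),
  (Num.floor (t%:R * b) - Num.floor (s%:R * b)); split.
- by rewrite subn_gt0 lt_st /= (leq_trans (leq_subr _ _)) // -ltnS.
- by rewrite natrB ?(ltnW lt_st) // mulrBl.
- by rewrite natrB ?(ltnW lt_st) // mulrBl.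
Qed.

(** The Lucas sequence of the second kind: the power sums of the two roots of [X^2 - u X + v]. *)
Fixpoint lucas_V (u v : int) (k : nat) : int :=
  if k is k1.+1 then
    if k1 is k2.+1 then u * lucas_V u v k1 - v * lucas_V u v k2 else u
  else 2.

Lemma lucas_VSS u v k : lucas_V u v k.+2 = u * lucas_V u v k.+1 - v * lucas_V u v k.
Proof. by []. Qed.

Lemma lucas_VE (R : comNzRingType) (x y : R) (u v : int) k :
  x + y = u%:~R -> x * y = v%:~R -> x ^+ k + y ^+ k = (lucas_V u v k)%:~R.
Proof.
move=> xy_u xy_v.
suff [] : x ^+ k + y ^+ k = (lucas_V u v k)%:~R /\
          x ^+ k.+1 + y ^+ k.+1 = (lucas_V u v k.+1)%:~R by [].
elim: k => [|k [IH0 IH1]]; first by rewrite !expr0 !expr1.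
split=> //; rewrite lucas_VSS intrB !intrM -IH0 -IH1 -xy_u -xy_v !exprS.
by ring.
Qed.

(** Induction in steps of two from [V_1 = u]: modulo [u], the recurrence reads
    [V_(k+2) = - v V_k]. *)
Lemma dvdz_lucas_V_odd u v k : odd k -> (u %| lucas_V u v k)%Z.
Proof.
move=> k_odd; rewrite -(odd_double_half k) k_odd add1n -addnn.
elim: k./2 => [|i IHi]; first exact: dvdzz.
rewrite addnS addSn lucas_VSS -!addnS; apply: rpredB; first exact: dvdz_mulr.
by apply: dvdz_mull; rewrite addnS.
Qed.

(** Modulo [v] the recurrence is multiplication by [u]. The index starts at 1 because [V_0 = 2]
    differs from [u^0]. *)
Lemma lucas_V_mod u v k : (v %| lucas_V u v k.+1 - u ^+ k.+1)%Z.
Proof.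
elim: k => [|k IHk]; first by rewrite /= subrr dvdz0.
have -> : lucas_V u v k.+2 - u ^+ k.+2 =
    u * (lucas_V u v k.+1 - u ^+ k.+1) - v * lucas_V u v k.
  by rewrite lucas_VSS (exprS _ k.+1); ring.
by apply: rpredB; [exact: dvdz_mull|exact: dvdz_mulr].
Qed.

(** Equality would give [u | T], hence [|T - u^j| <= T + T^n < Y], while [Y] divides [T - u^j]. So
    [T = u^j], and the [q]-adic valuation of [T] would be a multiple of [j >= 3], although it is 1
    or 2. *)
Lemma lucas_V_neq (u : int) (T Y q k j n : nat) : odd j -> (2 < j <= n)%N ->
  (0 < k)%N -> (T + T ^ n < Y)%N -> (0 < logn q T < 3)%N ->
  T%:Z <> lucas_V u (Y ^ k)%N%:Z j.
Proof.
move=> j_odd /andP[j_gt2 j_le] k_gt0 Y_big /andP[qT_gt0 qT_lt] TV.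
have T_gt0 : (0 < T)%N by case: (posnP T) qT_gt0 => // ->; rewrite logn0.
have uT : (`|u| %| T)%N.
  by have := dvdz_lucas_V_odd u (Y ^ k)%N%:Z j_odd; rewrite -TV.
have u_le : (`|u| <= T)%N by exact: dvdn_leq.
have YT : (Y%:Z %| T%:Z - u ^+ j)%Z.
  have := lucas_V_mod u (Y ^ k)%N%:Z j.-1; rewrite prednK ?(ltn_trans _ j_gt2) // -TV.
  by apply: dvdz_trans; rewrite dvdzE /= dvdn_exp.
have Tu : T%:Z = u ^+ j.
  apply/eqP; rewrite -subr_eq0; apply: contraLR YT => nz.
  rewrite dvdzE /= gtnNdvd //; first by rewrite absz_gt0.
  apply: leq_ltn_trans Y_big.
  have : (`|u| ^ j <= T ^ n)%N.
    apply: (@leq_trans (T ^ j)); last by rewrite leq_pexp2l.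
    by rewrite leq_exp2r // (ltn_trans _ j_gt2).
  by rewrite -abszX; lia.
have := congr1 (fun z : int => logn q `|z|%N) Tu.
rewrite /= abszX lognX => eT; move: qT_gt0 qT_lt; rewrite eT.
by case: (logn q `|u|%N) => [|[|l]]; nia.
Qed.


(** * Subfields of [algC] and integrality of roots of quadratic polynomials *)

Lemma divring_closed_rat (S : {pred algC}) (a : rat) :
  GRing.divring_closed S -> ratr a \in S.
Proof.
case=> S1 SB SD.
have S0 : 0 \in S by rewrite -(subrr 1) SB.
have SN x : x \in S -> - x \in S by move=> Sx; rewrite -sub0r SB.
have Snat k : k%:R \in S.
  elim: k => [//|k IHk]; rewrite -natr1 -[X in _ + X]opprK SB //.
  exact: SN.
have Sint z : z%:~R \in S.
  by case: z => k; rewrite ?NegzE ?mulrNz; [|apply: SN]; apply: Snat.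
by rewrite /ratr SD.
Qed.

Lemma divring_closedD (S : {pred algC}) (x y : algC) :
  GRing.divring_closed S -> x \in S -> y \in S -> x + y \in S.
Proof.
case=> S1 SB SD Sx Sy; rewrite -[y]opprK SB // -sub0r SB //.
by rewrite -(subrr 1) SB.
Qed.

Lemma divring_closedM (S : {pred algC}) (x y : algC) :
  GRing.divring_closed S -> x \in S -> y \in S -> x * y \in S.
Proof. by case=> S1 SB SD Sx Sy; rewrite -[y]invrK SD // -div1r SD. Qed.

Lemma quadratic_Aint (t n x : algC) : t \in Num.int -> n \in Num.int ->
  x ^+ 2 - t * x + n = 0 -> x \in Aint.
Proof.
move=> tZ nZ x0; apply: (@root_monic_Aint ('X^2 + (n%:P - t *: 'X))).
- by rewrite /root !hornerE /=; apply/eqP; rewrite -[RHS]x0; ring.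
- have lt2 : (size (n%:P - t *: 'X)%R < size ('X^2 : {poly algC})%R)%N.
    rewrite size_polyXn ltnS (leq_trans (size_polyD _ _)) // geq_max.
    rewrite size_polyN (leq_trans (size_polyC_leq1 _)) //.
    by rewrite (leq_trans (size_scale_leq _ _)) // size_polyX.
  by rewrite monicE lead_coefDl // lead_coefXn.
apply/polyOverP => i; rewrite !coefE.
apply: rpredD; first by rewrite rpred_nat.
apply: rpredB; first by case: (i == 0%N); rewrite ?rpred0.
by apply: rpredM => //; rewrite rpred_nat.
Qed.

(** * Imaginary quadratic fields inside algC *)

Section ImaginaryQuadratic.

Variable E : nat.
Hypothesis E_gt0 : (0 < E)%N.

Let K := Qsqrt (- E%:Z).
Let O := ring_of_integers K.
Let delta : algC := sqrtC (- E%:Z)%:~R.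

Lemma delta2 : delta ^+ 2 = - E%:R.
Proof. by rewrite sqrtCK mulrNz. Qed.

Lemma E_gt0C : 0 < E%:R :> algC.
Proof. by rewrite ltr0n. Qed.

(** The conjugate has the same square, so it is [delta] or [- delta]; the first would make [delta]
    real with a negative square. *)
Lemma conj_delta : delta^* = - delta.
Proof.
have /eqP : delta^* ^+ 2 = delta ^+ 2.
  by rewrite -rmorphXn delta2 rmorphN rmorph_nat.
rewrite eqf_sqr => /orP[/eqP r|/eqP//].
have dR : delta \is Num.real by apply/CrealP.
have := real_exprn_even_ge0 (n := 2) dR isT.
by rewrite delta2 oppr_ge0 lt_geF ?E_gt0C.
Qed.

Lemma delta_neq0 : delta != 0.
Proof. by rewrite -sqrf_eq0 delta2 oppr_eq0 gt_eqF ?E_gt0C. Qed.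

Lemma conj_rat_delta (a b : rat) :
  (ratr a + ratr b * delta)^* = ratr a - ratr b * delta.
Proof.
by rewrite rmorphD [X in _ + X]rmorphM /= conj_delta !conj_Crat ?Crat_rat // mulrN.
Qed.

Lemma norm_rat_delta (a b : rat) :
  (ratr a + ratr b * delta) * (ratr a + ratr b * delta)^* =
  ratr (a ^+ 2 + b ^+ 2 * E%:R).
Proof.
rewrite conj_rat_delta.
rewrite rmorphD rmorphM !rmorphXn /= ratr_nat.
have -> : (ratr a + ratr b * delta) * (ratr a - ratr b * delta) =
   ratr a ^+ 2 - ratr b ^+ 2 * delta ^+ 2 by ring.
by rewrite delta2 mulrN opprK.
Qed.

Lemma QsqrtP x : K x <-> exists a b : rat, x = ratr a + ratr b * delta.
Proof.
split=> [|[a [b ->]] S Sd Sdelta]; last first.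
  apply: divring_closedD => //; first exact: divring_closed_rat.
  by apply: divring_closedM => //; exact: divring_closed_rat.
move=> /(_ [pred x | `[< exists a b : rat, x = ratr a + ratr b * delta >]]) H.
apply/asboolP/H; last first.
  by apply/asboolP; exists 0, 1; rewrite rmorph0 rmorph1 mul1r add0r.
split=> [|u v|u v].
- by apply/asboolP; exists 1, 0; rewrite rmorph0 rmorph1 mul0r addr0.
- move=> /asboolP[a [b ->]] /asboolP[c [d ->]]; apply/asboolP.
  by exists (a - c), (b - d); rewrite !rmorphB /=; ring.
- move=> /asboolP[a [b ->]] /asboolP[c [d ->]]; apply/asboolP.
  (* The quotient is expanded with the conjugate of the divisor, whose norm is [q]. A zero divisor
     is covered too, as inverting 0 gives 0. *)
  have [q qE] : {q | q = c ^+ 2 + d ^+ 2 * E%:R} by eexists.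
  exists ((a * c + b * d * E%:R) / q), ((b * c - a * d) / q).
  rewrite invC_norm normCK norm_rat_delta -qE.
  rewrite conj_rat_delta.
  rewrite [ratr (_ / q)]rmorphM [ratr ((b * c - _) / q)]rmorphM !fmorphV /=.
  rewrite [ratr (_ + _)]rmorphD [ratr (_ - _)]rmorphB !rmorphM /= ratr_nat.
  have -> : E%:R = - delta ^+ 2 by rewrite delta2 opprK.
  by ring.
Qed.

Lemma Qsqrt_rat (a : rat) : K (ratr a).
Proof. by move=> S Sd _; apply: divring_closed_rat. Qed.

Lemma Qsqrt_int (z : int) : K z%:~R.
Proof. by rewrite -(ratr_int algC); apply: Qsqrt_rat. Qed.

Lemma Qsqrt_delta : K delta.
Proof. by move=> S Sd. Qed.

Lemma QsqrtD x y : K x -> K y -> K (x + y).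
Proof. by move=> Kx Ky S Sd Se; apply: divring_closedD; [|apply: Kx|apply: Ky]. Qed.

Lemma QsqrtM x y : K x -> K y -> K (x * y).
Proof. by move=> Kx Ky S Sd Se; apply: divring_closedM; [|apply: Kx|apply: Ky]. Qed.

Lemma QsqrtV x : K x -> K x^-1.
Proof. by move=> Kx S Sd Se; case: (Sd) => S1 _ SD; rewrite -div1r SD //; apply: Kx. Qed.

Lemma QsqrtN x : K x -> K (- x).
Proof. by move=> Kx; rewrite -mulN1r; apply: QsqrtM => //; apply: (Qsqrt_int (-1)). Qed.

Lemma QsqrtX x k : K x -> K (x ^+ k).
Proof.
move=> Kx; elim: k => [|k IHk]; first exact: (Qsqrt_int 1).
by rewrite exprS; apply: QsqrtM.
Qed.

Lemma Qsqrt_conj x : K x -> K x^*.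
Proof.
move=> /QsqrtP[a [b ->]]; apply/QsqrtP; exists a, (- b).
by rewrite conj_rat_delta rmorphN mulNr.
Qed.

Lemma Qsqrt_norm x : K x -> x * x^* \in Crat.
Proof. by move=> /QsqrtP[a [b ->]]; rewrite norm_rat_delta Crat_rat. Qed.

Lemma Qsqrt_trace x : K x -> x + x^* \in Crat.
Proof.
move=> /QsqrtP[a [b ->]]; apply/CratP; exists (2 * a).
rewrite conj_rat_delta.
by rewrite rmorphM rmorph_nat /=; ring.
Qed.

Lemma Qsqrt_cotrace x : K x -> (x - x^*) * delta \in Crat.
Proof.
move=> /QsqrtP[a [b ->]]; apply/CratP; exists (- (2 * b * E%:R)).
rewrite conj_rat_delta.
rewrite rmorphN !rmorphM !rmorph_nat /=.
have -> : E%:R = - delta ^+ 2 by rewrite delta2 opprK.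
by ring.
Qed.

(** * The ring of integers: norms, traces, multipliers of ideals and units *)

Lemma Oint (z : int) : O z%:~R.
Proof. by split; [exact: Qsqrt_int | exact: Aint_int]. Qed.

Lemma Onat (k : nat) : O k%:R.
Proof. exact: (Oint k). Qed.

Lemma Odelta : O delta.
Proof.
split; first exact: Qsqrt_delta.
apply: (@quadratic_Aint 0 E%:R); rewrite ?rpred0 ?rpred_nat //.
by rewrite mul0r subr0 delta2 addNr.
Qed.

Lemma OD x y : O x -> O y -> O (x + y).
Proof. by move=> [Kx Ax] [Ky Ay]; split; [exact: QsqrtD|exact: rpredD]. Qed.

Lemma OM x y : O x -> O y -> O (x * y).
Proof. by move=> [Kx Ax] [Ky Ay]; split; [exact: QsqrtM|exact: rpredM]. Qed.

Lemma ON x : O x -> O (- x).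
Proof. by move=> [Kx Ax]; split; [exact: QsqrtN|rewrite rpredN]. Qed.

Lemma OB x y : O x -> O y -> O (x - y).
Proof. by move=> Ox Oy; apply: OD => //; apply: ON. Qed.

Lemma OX x k : O x -> O (x ^+ k).
Proof. by move=> [Kx Ax]; split; [exact: QsqrtX|exact: rpredX]. Qed.

Lemma Oconj x : O x -> O x^*.
Proof. by move=> [Kx Ax]; split; [exact: Qsqrt_conj|rewrite Aint_aut]. Qed.

Lemma Onorm x : O x -> x * x^* \in Num.int.
Proof.
move=> Ox; apply: Cint_rat_Aint; first by apply: Qsqrt_norm; case: Ox.
by case: (OM Ox (Oconj Ox)).
Qed.

Lemma Otrace x : O x -> x + x^* \in Num.int.
Proof.
move=> Ox; apply: Cint_rat_Aint; first by apply: Qsqrt_trace; case: Ox.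
by case: (OD Ox (Oconj Ox)).
Qed.

(** An integer-valued substitute for the coefficient of [delta]; together with the trace it
    determines [x]. *)
Lemma Ocotrace x : O x -> (x - x^*) * delta \in Num.int.
Proof.
move=> Ox; apply: Cint_rat_Aint; first by apply: Qsqrt_cotrace; case: Ox.
by case: (OM (OB Ox (Oconj Ox)) Odelta).
Qed.

Lemma O_trace_norm x : K x -> x + x^* \in Num.int -> x * x^* \in Num.int -> O x.
Proof.
move=> Kx tx nx; split => //.
by apply: (quadratic_Aint tx nx); ring.
Qed.

(** For a nonzero [y] in [I] and a denominator [r], all [r * x ^+ k * y] are integral. So the norm
    of [r * y] times any power of the norm of [x] is an integer, and denominators stay bounded. *)
Lemma norm_multiplier_int (I : set algC) (x : algC) : fractional_ideal K I ->
  K x -> (forall y, I y -> I (x * y)) -> x * x^* \in Num.int.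
Proof.
move=> FI Kx xI; have [y Iy y0] := fideal_nz FI.
have [r [_ r0 rI]] := fideal_denom FI.
have Ixy k : I (x ^+ k * y).
  by elim: k => [|k IHk]; rewrite ?mul1r // exprS -mulrA; apply: xI.
have /CratP[q qE] := Qsqrt_norm Kx.
have Kry : K (r * y) by case: (rI _ Iy).
have /CratP[M ME] := Qsqrt_norm Kry.
rewrite qE Cint_rat; apply: (@bounded_denominator_int M).
  by rewrite -(fmorph_eq0 (ratr : rat -> algC)) /= -ME mul_conjC_eq0 mulf_neq0.
move=> k; rewrite -Cint_rat rmorphM rmorphXn /= -ME -qE.
have := Onorm (rI _ (Ixy k)); congr (_ \in Num.int).
by rewrite !rmorphM rmorphXn /= exprMn; ring.
Qed.

(** Both [x] and [1 + x] are multipliers of [I], so both have integral norm; the trace of [x] is the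
    difference of these norms minus 1. *)
Lemma multiplier_integral (I : set algC) (x : algC) : fractional_ideal K I ->
  K x -> (forall y, I y -> I (x * y)) -> O x.
Proof.
move=> FI Kx xI; have nx := norm_multiplier_int FI Kx xI.
have K1x : K (1 + x) by apply: QsqrtD => //; apply: (Qsqrt_int 1).
have n1x : (1 + x) * (1 + x)^* \in Num.int.
  apply: (norm_multiplier_int FI K1x) => y Iy.
  by rewrite mulrDl mul1r; apply: (fideal_D FI) => //; apply: xI.
apply: O_trace_norm => //.
have -> : x + x^* = (1 + x) * (1 + x)^* - x * x^* - 1.
  by rewrite rmorphD rmorph1 /=; ring.
by rewrite !rpredB ?rpred1.
Qed.

Lemma unit_norm1 x : x != 0 -> O x -> O x^-1 -> x * x^* = 1.
Proof.
move=> x0 /Onorm n1 /Onorm; rewrite fmorphV -invfM => n2.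
have n_ge0 : 0 <= x * x^* by exact: mul_conjC_ge0.
have n0 : x * x^* != 0 by rewrite mul_conjC_eq0.
have /natrP[a aE] : x * x^* \in Num.nat by rewrite natrEint n1.
have /natrP[b bE] : (x * x^*)^-1 \in Num.nat by rewrite natrEint n2 invr_ge0.
have /eqP : (a * b)%:R = 1 :> algC by rewrite natrM -aE -bE divff.
by rewrite aE (eqr_nat _ _ 1%N) muln_eq1 => /andP[/eqP-> _].
Qed.

(* An element of norm 1 and trace t satisfies t^2 - 4 = -E s^2 with s rational;
   t = 0 and t = 1, -1 would make E, respectively 3E, a square. *)
Lemma unit_pm1 x : (forall c, E <> (c ^ 2)%N) -> (forall c, (3 * E)%N <> (c ^ 2)%N) ->
  x != 0 -> O x -> O x^-1 -> x = 1 \/ x = -1.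
Proof.
move=> E_nsq E3_nsq x0 Ox Oxi; have n1 := unit_norm1 x0 Ox Oxi.
have /intrP[t tE] := Otrace Ox; move: n1 tE.
have /QsqrtP[a [b ->]] : K x by case: Ox.
rewrite norm_rat_delta conj_rat_delta -[1 in RHS](ratr_int _ 1) -[t%:~R](ratr_int algC).
move=> /fmorph_inj n1.
have -> : ratr a + ratr b * delta + (ratr a - ratr b * delta) = ratr (2 * a).
  by rewrite rmorphM rmorph_nat /=; ring.
move=> /fmorph_inj tE.
have eqb : E%:R * (2 * b) ^+ 2 = 4 - t%:~R ^+ 2 :> rat.
  have {}n1 : a ^+ 2 + b ^+ 2 * E%:R = 1 by exact: n1.
  rewrite -tE; have -> : 4 = 4 * (a ^+ 2 + b ^+ 2 * E%:R) by rewrite n1.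
  by ring.
have sqb_ge0 : 0 <= (2 * b) ^+ 2 by exact: sqr_ge0.
have E_gt0Q : 0 < E%:R :> rat by rewrite ltr0n.
have t2 : t ^+ 2 <= 4.
  rewrite -(ler_int rat) rmorphXn /= -subr_ge0 -[4%:~R]/(4 : rat) -eqb.
  by rewrite mulr_ge0 // ltW.
have b0P : b = 0 -> ratr a + ratr b * delta = ratr (t%:~R / 2) :> algC.
  by move=> ->; rewrite rmorph0 mul0r addr0 -tE mulrC mulKf.
have bnz : t%:~R ^+ 2 != 4 :> rat -> 2 * b != 0.
  apply: contra => /eqP b0; move: eqb; rewrite b0 expr0n mulr0 => /esym/eqP.
  by rewrite subr_eq0 eq_sym.
have b_eq0 : t%:~R ^+ 2 = 4 :> rat -> b = 0.
  move=> t4; move: eqb; rewrite t4 subrr => /eqP.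
  by rewrite mulf_eq0 gt_eqF //= expf_eq0 /= mulf_eq0 /= => /eqP.
have : t = 0 \/ (t = 1 \/ t = -1) \/ t = 2 \/ t = -2.
  have : -2 <= t <= 2 by apply/andP; split; nia.
  by lia.
case=> [t0|[t1|[tv|tv]]].
- case: (@square_ratio_rat E (2 / (2 * b))) => [|c /E_nsq//].
  have := eqb; rewrite t0 expr0n subr0 => {}eqb.
  have /bnz b0 : t%:~R ^+ 2 != 4 :> rat by rewrite t0.
  by rewrite expr_div_n -[2 ^+ 2]eqb mulfK // expf_neq0.
- have tQ : t%:~R ^+ 2 = 1 :> rat by case: t1 => ->.
  case: (@square_ratio_rat (3 * E) (3 / (2 * b))) => [|c /E3_nsq//].
  have /bnz b0 : t%:~R ^+ 2 != 4 :> rat by rewrite tQ.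
  rewrite expr_div_n natrM.
  have -> : 3 ^+ 2 = 3 * (E%:R * (2 * b) ^+ 2) :> rat by rewrite eqb tQ.
  by rewrite mulrA mulfK // expf_neq0.
- by left; rewrite b0P ?tv ?b_eq0 ?tv // divff // rmorph1.
- by right; rewrite b0P ?tv ?b_eq0 ?tv // mulNr divff // rmorphN1.
Qed.

(** * Ideals modulo scaling *)

Definition scale_set (c : algC) (I : set algC) : set algC := [set c * x | x in I].

Lemma scale_set1 I : scale_set 1 I = I.
Proof.
by apply/seteqP; split=> [_ [x Ix <-]|x Ix]; [rewrite mul1r|exists x; rewrite ?mul1r].
Qed.

Lemma scale_setM c d I : scale_set c (scale_set d I) = scale_set (c * d) I.
Proof.
apply/seteqP; split=> [_ [_ [x Ix <-] <-]|_ [x Ix <-]].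
  by exists x => //; rewrite mulrA.
by exists (d * x); [exists x|rewrite mulrA].
Qed.

(** Each summand is an element of [I] times a multiple of [c], so the sum collapses to [c] times one
    element of [I]. Ideal classes thereby become orbits under scaling. *)
Lemma ideal_mul_principal I c : fractional_ideal K I ->
  ideal_mul I (principal_ideal K c) = scale_set c I.
Proof.
move=> FI; apply/seteqP; split=> [_ [s sI ->]|_ [x Ix <-]]; last first.
  exists [:: (x, c)] => [u|]; last by rewrite big_seq1 mulrC.
  rewrite inE => /eqP-> /=; split=> //; exists 1; rewrite ?mulr1 //; exact: (Oint 1).
elim: s sI => [|u s IHs] sI.
  by exists 0; [exact: fideal_0 FI|rewrite big_nil mulr0].
have [Iu [r Or rE]] := sI u (mem_head _ _).
have [v Iv vE] : scale_set c I (\sum_(w <- s) w.1 * w.2).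
  by apply: IHs => w ws; apply: sI; rewrite inE ws orbT.
exists (r * u.1 + v); first by apply: (fideal_D FI) => //; apply: (fideal_M FI).
by rewrite big_cons -rE -vE; ring.
Qed.

Lemma ideal_classE I : fractional_ideal K I ->
  ideal_class K I = [set scale_set c I | c in [set c | K c /\ c != 0]].
Proof.
by move=> FI; apply: eq_imagel => c _; rewrite ideal_mul_principal.
Qed.

Lemma scale_fractional c I : K c -> c != 0 -> fractional_ideal K I ->
  fractional_ideal K (scale_set c I).
Proof.
move=> Kc c0 FI; split.
- by move=> _ [x Ix <-]; apply: QsqrtM => //; apply: (fideal_sub FI).
- by exists 0; rewrite ?mulr0 //; exact: fideal_0 FI.
- move=> _ _ [x Ix <-] [y Iy <-]; exists (x + y); last by rewrite mulrDr.
  exact: (fideal_D FI).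
- move=> r _ Or [x Ix <-]; exists (r * x); last by rewrite mulrCA.
  exact: (fideal_M FI).
- have [x Ix x0] := fideal_nz FI.
  by exists (c * x); [exists x|rewrite mulf_neq0].
have [r [Or r0 rI]] := fideal_denom FI.
(* The product of the denominators of the two rational coordinates of [c] serves as [d]. *)
have [d [Od d0 dcO]] : exists d, [/\ O d, d != 0 & O (d * c)].
  have /QsqrtP[a [b ->]] := Kc.
  exists (denq a * denq b)%:~R; split; first exact: Oint.
    by rewrite intr_eq0 mulf_neq0 ?denq_eq0.
  have -> : (denq a * denq b)%:~R * (ratr a + ratr b * delta) =
      (denq b * numq a)%:~R + (denq a * numq b)%:~R * delta :> algC.
    have da : (denq a)%:~R != 0 :> algC by rewrite intr_eq0 denq_eq0.
    have db : (denq b)%:~R != 0 :> algC by rewrite intr_eq0 denq_eq0.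
    by rewrite /ratr !intrM; field; rewrite da db.
  by apply: OD; [exact: Oint|apply: OM; [exact: Oint|exact: Odelta]].
exists (r * d); split; [exact: OM|exact: mulf_neq0|].
move=> _ [x Ix <-]; have -> : r * d * (c * x) = (d * c) * (r * x) by ring.
by apply: OM => //; apply: rI.
Qed.

Lemma ideal_class_eqP I J : fractional_ideal K I -> fractional_ideal K J ->
  ideal_class K I = ideal_class K J <->
  exists c, [/\ K c, c != 0 & J = scale_set c I].
Proof.
move=> FI FJ; rewrite !ideal_classE //; split=> [eqIJ|[c [Kc c0 ->]]].
  have : [set scale_set c J | c in [set c | K c /\ c != 0]] J.
    by exists 1; [split; [exact: (Qsqrt_int 1)|exact: oner_neq0]|exact: scale_set1].
  by rewrite -eqIJ => -[c [Kc c0] <-]; exists c.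
apply/seteqP; split=> _ [d [Kd d0] <-].
  exists (d / c); last by rewrite scale_setM divfK.
  by split; [apply: QsqrtM => //; exact: QsqrtV|rewrite mulf_neq0 ?invr_eq0].
by exists (d * c); [split; [exact: QsqrtM|exact: mulf_neq0]|rewrite scale_setM].
Qed.

(** The product of [I] with the ideal generated by [Y] and [alpha]; two summands suffice when [I] is
    closed under addition and under multiplication by integers of [K]. *)
Definition gen2_mul (Y alpha : algC) (I : set algC) : set algC :=
  [set Y * x + alpha * y | x in I & y in I].

Lemma gen2_mul_scale Y alpha c I :
  gen2_mul Y alpha (scale_set c I) = scale_set c (gen2_mul Y alpha I).
Proof.
apply/seteqP; split=> [_ [_ [x Ix <-] [_ [y Iy <-] <-]]|_ [_ [x Ix [y Iy <-]] <-]].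
  by exists (Y * x + alpha * y); [exists x => //; exists y|ring].
by exists (c * x); [exists x|exists (c * y); [exists y|ring]].
Qed.

Lemma gen2_mul_fractional Y alpha I : O Y -> Y != 0 -> O alpha ->
  fractional_ideal K I -> fractional_ideal K (gen2_mul Y alpha I).
Proof.
move=> OY Y0 Oa FI; have I0 := fideal_0 FI.
have sub_I x : gen2_mul Y alpha I x -> I x.
  move=> [u Iu [v Iv <-]]; apply: (fideal_D FI); exact: (fideal_M FI).
split.
- by move=> x /sub_I /(fideal_sub FI).
- by exists 0 => //; exists 0 => //; rewrite !mulr0 addr0.
- move=> _ _ [u Iu [v Iv <-]] [w Iw [z Iz <-]].
  exists (u + w); first exact: (fideal_D FI).
  exists (v + z); first exact: (fideal_D FI).
  by ring.
- move=> r _ Or [u Iu [v Iv <-]].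
  exists (r * u); first exact: (fideal_M FI).
  exists (r * v); first exact: (fideal_M FI).
  by ring.
- have [x Ix x0] := fideal_nz FI.
  exists (Y * x); last by rewrite mulf_neq0.
  by exists x => //; exists 0 => //; rewrite mulr0 addr0.
have [r [Or r0 rI]] := fideal_denom FI.
by exists r; split=> // x /sub_I /rI.
Qed.

(** * Multiplication by the ideal [(Y, alpha)] as a map on the class group *)

Section ClassMap.

Variables (n T Y : nat) (alpha : algC).
Hypotheses (Oalpha : O alpha) (Y_gt0 : (0 < Y)%N) (n_gt0 : (0 < n)%N).
Hypotheses (alpha_trace : alpha + alpha^* = T%:R).
Hypotheses (alpha_norm : alpha * alpha^* = Y%:R ^+ n).
Hypothesis coprime_TY : coprime T Y.

Let F := gen2_mul Y%:R alpha.

Lemma Y_neq0 : Y%:R != 0 :> algC.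
Proof. by rewrite pnatr_eq0 -lt0n. Qed.

Lemma alpha_neq0 : alpha != 0.
Proof.
apply/eqP => a0; move/eqP: alpha_norm.
by rewrite a0 mul0r eq_sym expf_eq0 (negPf Y_neq0) andbF.
Qed.

Lemma Oalpha_conj : O alpha^*.
Proof. exact: Oconj. Qed.

(* With u T + v Y = 1 and alpha^2 = T alpha - Y^n, the ideal (Y alpha, alpha^2)
   + (Y^(k+1)) contains alpha. *)
Lemma gen2_mul_step I k : fractional_ideal K I -> (k < n)%N ->
  F (gen2_mul (Y%:R ^+ k) alpha I) = gen2_mul (Y%:R ^+ k.+1) alpha I.
Proof.
move=> FI k_lt; have ID := fideal_D FI; have IM := fideal_M FI.
have OYk i : O (Y%:R ^+ i) by apply: OX; exact: Onat.
apply/seteqP; split=> [_ [_ [x Ix [y Iy <-]] [_ [z Iz [w Iw <-]] <-]]|].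
  exists x => //; exists (Y%:R * y + (Y%:R ^+ k * z + alpha * w)).
    apply: (ID _ _ _ (ID _ _ _ _)); apply: IM => //.
    + exact: Onat.
    + exact: OYk.
  by rewrite exprS; ring.
move=> _ [x Ix [y Iy <-]].
have [[u v] uv] : exists uv : int * int, uv.1 * T%:Z + uv.2 * Y%:Z = 1.
  have /coprimezP : coprimez T Y by [].
  by move=> [[u v]]; exists (u, v).
have uvC : u%:~R * T%:R + v%:~R * Y%:R = 1 :> algC.
  by have /(congr1 (fun z : int => z%:~R : algC)) := uv; rewrite /= intrD !intrM.
have Iuy : I (u%:~R * y) by apply: IM => //; exact: Oint.
(* The witnesses come from [alpha = (u T + v Y) alpha] and [T alpha = alpha^2 + Y^n]: the multiples
   of [Y] go here, and the [alpha^2] term into the second component. *)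
exists (Y%:R ^+ k * (x + Y%:R ^+ (n - k.+1) * (u%:~R * y)) + alpha * (v%:~R * y)).
  exists (x + Y%:R ^+ (n - k.+1) * (u%:~R * y)).
    by apply: ID => //; apply: IM => //; exact: OYk.
  by exists (v%:~R * y) => //; apply: IM => //; exact: Oint.
exists (alpha * (u%:~R * y)).
  exists 0; first exact: fideal_0 FI.
  by exists (u%:~R * y) => //; rewrite mulr0 add0r.
have aa : alpha * alpha = T%:R * alpha - Y%:R ^+ n.
  by rewrite -alpha_trace -alpha_norm; ring.
have -> : Y%:R ^+ k.+1 * x + alpha * y =
    Y%:R ^+ k.+1 * x + (u%:~R * T%:R + v%:~R * Y%:R) * alpha * y.
  by rewrite uvC mul1r.
have -> : alpha * (alpha * (u%:~R * y)) = (alpha * alpha) * (u%:~R * y) by ring.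
have nE : (k.+1 + (n - k.+1) = n)%N by rewrite subnKC.
rewrite aa -[in X in _ - X]nE exprD !exprS.
by ring.
Qed.

Lemma iter_gen2 I k : fractional_ideal K I -> (0 < k <= n)%N ->
  iter k F I = gen2_mul (Y%:R ^+ k) alpha I.
Proof.
move=> FI; elim: k => [//|[|k] IHk] k_le; first by rewrite /= /F expr1.
by rewrite iterS IHk ?(ltnW k_le) // gen2_mul_step.
Qed.

(** As [Y^n] is the norm of [alpha], it is a multiple of [alpha], so the ideal [(Y^n, alpha)] is
    just [(alpha)]. *)
Lemma iter_gen2_n I : fractional_ideal K I -> iter n F I = scale_set alpha I.
Proof.
move=> FI; rewrite iter_gen2 ?n_gt0 ?leqnn // -alpha_norm.
apply/seteqP; split=> [_ [x Ix [y Iy <-]]|_ [y Iy <-]].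
  exists (alpha^* * x + y); last by ring.
  by apply: (fideal_D FI) => //; apply: (fideal_M FI) => //; exact: Oalpha_conj.
by exists 0; [exact: fideal_0 FI|exists y => //; rewrite mulr0 add0r].
Qed.

Lemma iter_gen2_scale c I k : iter k F (scale_set c I) = scale_set c (iter k F I).
Proof. by elim: k => [//|k IHk]; rewrite !iterS IHk /F gen2_mul_scale. Qed.

Lemma iter_gen2_fractional I k : fractional_ideal K I ->
  fractional_ideal K (iter k F I).
Proof.
move=> FI; elim: k => [//|k IHk]; rewrite iterS.
by apply: gen2_mul_fractional => //; [exact: Onat|exact: Y_neq0].
Qed.

Lemma gen2_class I : fractional_ideal K I ->
  F @` ideal_class K I = ideal_class K (F I).
Proof.
move=> FI; have FFI := iter_gen2_fractional 1 FI.
rewrite !ideal_classE //; apply/seteqP; split=> [_ [_ [c cP <-] <-]|_ [c cP <-]].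
  by exists c => //; rewrite /F gen2_mul_scale.
by exists (scale_set c I); [exists c|rewrite /F gen2_mul_scale].
Qed.

Lemma iter_gen2_class I k : fractional_ideal K I ->
  iter k (image^~ F) (ideal_class K I) = ideal_class K (iter k F I).
Proof.
move=> FI; elim: k => [//|k IHk]; rewrite !iterS IHk gen2_class //.
exact: iter_gen2_fractional.
Qed.

Lemma iter_gen2_class_n I : fractional_ideal K I ->
  ideal_class K (iter n F I) = ideal_class K I.
Proof.
move=> FI; apply/esym/ideal_class_eqP => //; first exact: iter_gen2_fractional.
exists alpha; split; [by case: Oalpha|exact: alpha_neq0|exact: iter_gen2_n].
Qed.

(** If [F^k I = c I], iterating [j = n / k] times yields [alpha I = c^j I]. Then [alpha / c^j] and
    its inverse both multiply [I] into itself, so it is a unit, hence 1 or -1, and the sign is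
    absorbed in [c] because [j] is odd. *)
Lemma gen2_fixed_power I k : (forall c, E <> (c ^ 2)%N) ->
  (forall c, (3 * E)%N <> (c ^ 2)%N) -> odd n ->
  fractional_ideal K I -> (0 < k)%N -> (k %| n)%N ->
  ideal_class K (iter k F I) = ideal_class K I ->
  exists2 beta, O beta & alpha = beta ^+ (n %/ k).
Proof.
move=> E_nsq E3_nsq n_odd FI k_gt0 k_dvd /esym.
have FkI := iter_gen2_fractional k FI.
move=> /(ideal_class_eqP FI FkI)[c [Kc c0 cI]].
set j := (n %/ k)%N; have jk : (j * k)%N = n by rewrite divnK.
have j_odd : odd j by move: n_odd; rewrite -jk oddM => /andP[].
have iterM i : iter (i * k) F I = scale_set (c ^+ i) I.
  elim: i => [|i IHi]; first by rewrite scale_set1.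
  by rewrite mulSn iterD IHi iter_gen2_scale cI scale_setM -exprSr.
have alphaI : scale_set alpha I = scale_set (c ^+ j) I.
  by rewrite -iter_gen2_n // -jk iterM.
(* Here [c I = F^k I] is contained in [I]. *)
have Oc : O c.
  apply: (multiplier_integral FI Kc) => y Iy.
  have : scale_set c I (c * y) by exists y.
  have k_itv : (0 < k <= n)%N by rewrite k_gt0 dvdn_leq.
  rewrite -cI (iter_gen2 FI k_itv) => -[x Ix [z Iz <-]].
  apply: (fideal_D FI); apply: (fideal_M FI) => //.
  by apply: OX; exact: Onat.
have cj0 : c ^+ j != 0 by rewrite expf_neq0.
pose e := alpha / c ^+ j.
have e0 : e != 0 by rewrite mulf_neq0 ?alpha_neq0 ?invr_eq0.
have Ke : K e by apply: QsqrtM; [case: Oalpha|apply: QsqrtV; apply: QsqrtX].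
have Oe : O e.
  apply: (multiplier_integral FI Ke) => y Iy.
  have : scale_set alpha I (alpha * y) by exists y.
  rewrite alphaI => -[z Iz zE].
  by have -> : e * y = z by rewrite /e mulrAC -zE mulrC mulKf.
have Oei : O e^-1.
  apply: (multiplier_integral FI (QsqrtV Ke)) => y Iy.
  have : scale_set (c ^+ j) I (c ^+ j * y) by exists y.
  rewrite -alphaI => -[z Iz zE].
  by have -> : e^-1 * y = z by rewrite /e invf_div mulrAC -zE mulrC mulKf ?alpha_neq0.
have e_odd : e ^+ j = e.
  have [->|->] := unit_pm1 E_nsq E3_nsq e0 Oe Oei; first by rewrite expr1n.
  by rewrite -signr_odd j_odd expr1.
exists (e * c); first exact: OM.
by rewrite exprMn e_odd /e divfK.
Qed.

(** A fixed class gives [alpha = beta^j]; then [T] is the trace of [beta^j], a Lucas number in the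
    trace and norm of [beta], which [lucas_V_neq] excludes. *)
Lemma iter_gen2_class_neq I k q : (forall c, E <> (c ^ 2)%N) ->
  (forall c, (3 * E)%N <> (c ^ 2)%N) -> odd n ->
  (T + T ^ n < Y)%N -> (0 < logn q T < 3)%N ->
  fractional_ideal K I -> (k %| n)%N -> (k < n)%N ->
  ideal_class K (iter k F I) <> ideal_class K I.
Proof.
move=> E_nsq E3_nsq n_odd Y_big qT FI k_dvd k_lt.
have k_gt0 : (0 < k)%N := dvdn_gt0 n_gt0 k_dvd.
move=> /(gen2_fixed_power E_nsq E3_nsq n_odd FI k_gt0 k_dvd)[beta Obeta].
set j := (n %/ k)%N; have jk : (j * k)%N = n by rewrite divnK.
have j_odd : odd j by move: n_odd; rewrite -jk oddM => /andP[].
have j_itv : (2 < j <= n)%N.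
  rewrite leq_div andbT; have : (1 < j)%N by rewrite ltn_divRL // mul1n.
  by case: (j) j_odd => [|[|[|]]].
move=> aE; have /intrP[u uE] := Otrace Obeta.
(* Both sides are nonnegative with the same [j]-th power [Y^n]. *)
have norm_beta : beta * beta^* = (Y ^ k)%N%:Z%:~R.
  apply/eqP; rewrite -[X in _ == X]/((Y ^ k)%N%:R : algC).
  rewrite -(@eqrXn2 _ j) ?(ltn_trans _ (proj1 (andP j_itv))) ?mul_conjC_ge0 ?ler0n //.
  by rewrite exprMn -rmorphXn -aE /= alpha_norm natrX -exprM mulnC jk.
have := lucas_VE j uE norm_beta.
rewrite -rmorphXn -aE /= alpha_trace => /eqP.
rewrite -[T%:R]/(T%:Z%:~R : algC) eqr_int => /eqP.
exact: (lucas_V_neq j_odd j_itv k_gt0 Y_big qT).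
Qed.

End ClassMap.

(** * Finiteness of the class group *)

(** A common multiple of all the multipliers [t <= (E + 2)^2] that the approximation with
    [L = E + 2] can produce. *)
Definition hurwitz_bound : nat := (E.+2 * E.+2)`!.

(** Approximating both coordinates within [1/L], with [L = E + 2], leaves a remainder of norm below
    [(1 + E) / L^2], which is at most 1. *)
Lemma hurwitz z : K z -> exists t w, [/\ (0 < t)%N, (t %| hurwitz_bound)%N, O w &
  (t%:R * z - w) * (t%:R * z - w)^* < 1].
Proof.
move=> /QsqrtP[a [b ->]].
have [//|t [u [v [t_itv ua vb]]]] := @simultaneous_approximation E.+2 a b.
exists t, (u%:~R + v%:~R * delta); split.
- by case/andP: t_itv.
- by rewrite dvdn_fact.
- by apply: OD; [exact: Oint|apply: OM; [exact: Oint|exact: Odelta]].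
set x := t%:R * a - u%:~R in ua; set y := t%:R * b - v%:~R in vb.
have -> : t%:R * (ratr a + ratr b * delta) - (u%:~R + v%:~R * delta) =
    ratr x + ratr y * delta :> algC.
  by rewrite !rmorphB !rmorphM /= !ratr_nat !ratr_int; ring.
suff xy_lt1 : x ^+ 2 + y ^+ 2 * E%:R < 1.
  by rewrite norm_rat_delta; move: xy_lt1; rewrite -(ltr_rat algC) rmorph1.
have L_gt0 : 0 < E.+2%:R :> rat by rewrite ltr0n.
have E_ge0 : 0 <= E%:R :> rat by rewrite ler0n.
have sq_lt c : `|c| < E.+2%:R^-1 :> rat -> c ^+ 2 * E.+2%:R ^+ 2 < 1.
  rewrite -[_^-1]mul1r ltr_pdivlMr // => lt_c; rewrite -real_normK ?num_real // -exprMn.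
  by rewrite expr_lt1 // mulr_ge0 // ltW.
have := sq_lt x ua; have := sq_lt y vb.
have LE : 1 + E%:R <= E.+2%:R ^+ 2 :> rat by rewrite -natr1 -natr1; nra.
have L2_gt0 : 0 < E.+2%:R ^+ 2 :> rat by rewrite exprn_gt0.
move: (E.+2%:R ^+ 2) LE L2_gt0 => L2 LE L2_gt0 hy hx.
rewrite -(ltr_pM2r L2_gt0) mul1r mulrDl [y ^+ 2 * _ * _]mulrAC; apply: lt_le_trans LE.
apply: ltr_leD => //; rewrite -[leRHS]mul1r.
by apply: ler_wpM2r => //; exact: ltW.
Qed.

(** Take [b] nonzero in [I] of minimal norm. For [x] in [I], [hurwitz] applied to [x / b] gives
    [t x - w b] in [I] of smaller norm, so it vanishes; multiplying by the cofactor of [t] gives a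
    bound that is uniform in [x]. *)
Lemma near_principal I : fractional_ideal K I ->
  exists b, [/\ I b, b != 0 & forall x, I x ->
    exists2 w, O w & hurwitz_bound%:R * x = w * b].
Proof.
move=> FI; have [r [Or r0 rI]] := fideal_denom FI.
pose N x : algC := (r * x) * (r * x)^*.
have N_nat x : I x -> N x \in Num.nat.
  by move=> Ix; rewrite natrEint mul_conjC_ge0 andbT; apply: Onorm; exact: rI.
pose P m := `[< exists x, [/\ I x, x != 0 & N x = m%:R] >].
have exP : exists m, P m.
  have [x Ix x0] := fideal_nz FI; have /natrP[m mE] := N_nat x Ix.
  by exists m; apply/asboolP; exists x.
have [m /asboolP[b [Ib b0 bm]] m_min] := ex_minnP exP.
exists b; split=> // x Ix.
have Kxb : K (x / b).
  by apply: QsqrtM; [|apply: QsqrtV]; exact: (fideal_sub FI).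
have [t [w [t_gt0 /dvdnP[s sE] Ow lt1]]] := hurwitz Kxb.
have y0 : t%:R * x - w * b = 0.
  apply/eqP/negPn/negP => ynz.
  have Iy : I (t%:R * x - w * b).
    rewrite -mulNr; apply: (fideal_D FI); apply: (fideal_M FI) => //.
      exact: Onat.
    exact: ON.
  have /natrP[l lE] := N_nat _ Iy.
  have /m_min : P l by apply/asboolP; exists (t%:R * x - w * b).
  apply/negP; rewrite -ltnNge -(ltr_nat algC) -lE -bm.
  have -> : N (t%:R * x - w * b) =
      (t%:R * (x / b) - w) * (t%:R * (x / b) - w)^* * N b.
    have -> : t%:R * x - w * b = (t%:R * (x / b) - w) * b.
      by rewrite mulrBl -mulrA divfK.
    by rewrite /N !rmorphM /=; ring.
  rewrite -[ltRHS]mul1r ltr_pM2r //.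
  by rewrite lt_neqAle mul_conjC_ge0 eq_sym mul_conjC_eq0 mulf_neq0.
exists (s%:R * w); first by apply: OM => //; exact: Onat.
by rewrite sE natrM -!mulrA; congr (_ * _); apply/eqP; rewrite -subr_eq0 y0.
Qed.

Lemma hurwitz_bound_neq0 : hurwitz_bound%:R != 0 :> algC.
Proof. by rewrite pnatr_eq0 -lt0n fact_gt0. Qed.

Definition bounded_ideals : set (set algC) :=
  [set J | [/\ fractional_ideal K J, J `<=` O & J hurwitz_bound%:R]].

(** Scaling by [hurwitz_bound / b] moves [I] into the integers and sends [b] to [hurwitz_bound]. *)
Lemma ideal_class_bounded I : fractional_ideal K I ->
  exists2 J, bounded_ideals J & ideal_class K J = ideal_class K I.
Proof.
move=> FI; have [b [Ib b0 bI]] := near_principal FI.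
pose c := hurwitz_bound%:R / b.
have Kc : K c.
  apply: QsqrtM; first exact: (Qsqrt_int hurwitz_bound).
  by apply: QsqrtV; exact: (fideal_sub FI).
have c0 : c != 0 by rewrite mulf_neq0 ?invr_eq0 ?hurwitz_bound_neq0.
have FJ := scale_fractional Kc c0 FI.
exists (scale_set c I); last by apply/esym/ideal_class_eqP => //; exists c.
split=> //; last by exists b => //; rewrite divfK.
move=> _ [x Ix <-]; have [w Ow wE] := bI x Ix.
by rewrite /c mulrAC wE mulfK.
Qed.

(** Trace and cotrace modulo [2 * E * hurwitz_bound]. On integers of [K] both are rational integers,
    and [Num.floor] only reads them as elements of [int]. *)
Definition residue (x : algC) :
    'I_(2 * E * hurwitz_bound).+1 * 'I_(2 * E * hurwitz_bound).+1 :=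
  let r z := inord `|(Num.floor z %% (2 * E * hurwitz_bound)%N)%Z|%N in
  (r (x + x^*), r ((x - x^*) * delta)).

(* 2 d = (d + d^* ) + (d - d^* ), so if trace and cotrace of d are divisible by
   2 E P then d is divisible by P. *)
Lemma residue_eq x y : O x -> O y -> residue x = residue y ->
  exists2 w, O w & x - y = w * hurwitz_bound%:R.
Proof.
move=> Ox Oy; rewrite /residue; set N := (2 * E * hurwitz_bound)%N.
have N_gt0 : (0 < N)%N by rewrite !muln_gt0 E_gt0 fact_gt0.
have resP (a b : algC) : a \in Num.int -> b \in Num.int ->
    inord `|(Num.floor a %% N)%Z|%N = inord `|(Num.floor b %% N)%Z|%N :> 'I_N.+1 ->
    exists k : int, a - b = k%:~R * N%:R.
  move=> /intrP[s ->] /intrP[t ->]; rewrite !intrKfloor => /(congr1 val) /=.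
  have mod_ge0 z : 0 <= (z %% N)%Z by rewrite modz_ge0 // eqz_nat -lt0n.
  have mod_lt z : (`|(z %% N)%Z| < N.+1)%N.
    have := ltz_pmod z (N_gt0 : 0 < N%:Z).
    by rewrite ltnS -lez_nat gez0_abs //; exact: ltW.
  rewrite !inordK ?mod_lt // => eq_mod.
  have {}eq_mod : (s %% N)%Z = (t %% N)%Z.
    by rewrite -[LHS]gez0_abs // -[RHS]gez0_abs // eq_mod.
  exists ((s %/ N)%Z - (t %/ N)%Z).
  rewrite {1}(divz_eq s N) {1}(divz_eq t N) eq_mod !intrD !intrM intrN /=.
  by ring.
case=> /(resP _ _ (Otrace Ox) (Otrace Oy))[k kE].
move=> /(resP _ _ (Ocotrace Ox) (Ocotrace Oy))[l lE].
(* Obtained by dividing by [2 * delta], using [E / delta = - delta]. *)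
exists (k%:~R * E%:R - l%:~R * delta).
  by apply: OB; apply: OM; [exact: Oint|exact: Onat|exact: Oint|exact: Odelta].
apply: (mulfI (_ : 2 * delta != 0)); first by rewrite mulf_neq0 ?delta_neq0 ?pnatr_eq0.
have -> : 2 * delta * (x - y) = delta * (x + x^* - (y + y^*)) +
   ((x - x^*) * delta - (y - y^*) * delta) by ring.
rewrite kE lE /N !natrM.
have -> : E%:R = - delta ^+ 2 by rewrite delta2 opprK.
by ring.
Qed.

(** An ideal containing [hurwitz_bound] is a union of classes modulo it, so [decode] recovers it
    from the set of residues of its elements, and there are finitely many such sets. *)
Lemma finite_bounded_ideals : finite_set bounded_ideals.
Proof.
pose decode C : set algC := [set x | O x /\ residue x \in (C : {set _})].
apply: (@sub_finite_set _ _ (decode @` setT)); last first.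
  exact/finite_image/finite_finset.
move=> J [FJ JO JP].
exists (finset (fun c => `[< exists2 x, J x & residue x = c >])) => //.
apply/seteqP; split=> [x [Ox]|x Jx]; last first.
  by split; [exact: JO|rewrite finset.inE; apply/asboolP; exists x].
rewrite finset.inE => /asboolP[y Jy /esym/(residue_eq Ox (JO _ Jy))[w Ow xy]].
rewrite -[x](subrK y) xy; apply: (fideal_D FJ) => //.
exact: (fideal_M FJ).
Qed.

Lemma finite_class_group : finite_set (class_group K).
Proof.
apply: (@sub_finite_set _ _ (ideal_class K @` bounded_ideals)); last first.
  exact/finite_image/finite_bounded_ideals.
by move=> _ [I FI <-]; have [J JB JE] := ideal_class_bounded FI; exists J.
Qed.

(** The norm equation provides [alpha = T/2 + b delta] with trace [T] and norm [Y^n]. Integrality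
    follows from these two values, so [b] may be any rational number. *)
Lemma class_number_divisible (n T Y q : nat) (b : rat) :
  (forall c, E <> (c ^ 2)%N) -> (forall c, (3 * E)%N <> (c ^ 2)%N) -> odd n ->
  coprime T Y -> (T + T ^ n < Y)%N -> (0 < logn q T < 3)%N ->
  (T%:R / 2) ^+ 2 + b ^+ 2 * E%:R = Y%:R ^+ n ->
  class_number_divisible_by K n.
Proof.
move=> E_nsq E3_nsq n_odd co_TY Y_big qT normE.
have [h Kh] := finite_class_group.
exists h => //.
pose alpha : algC := ratr (T%:R / 2) + ratr b * delta.
have n_gt0 : (0 < n)%N := odd_gt0 n_odd.
have Y_gt0 : (0 < Y)%N := leq_ltn_trans (leq0n _) Y_big.
have alpha_norm : alpha * alpha^* = Y%:R ^+ n.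
  by rewrite norm_rat_delta normE rmorphXn /= ratr_nat.
have alpha_trace : alpha + alpha^* = T%:R.
  rewrite /alpha conj_rat_delta addrACA subrr addr0 -rmorphD /=.
  by rewrite -splitr ratr_nat.
have Kalpha : K alpha by apply/QsqrtP; exists (T%:R / 2), b.
have Oalpha : O alpha.
  apply: O_trace_norm => //; first by rewrite alpha_trace rpred_nat.
  by rewrite alpha_norm rpredX // rpred_nat.
apply: (@dvdn_card_eq_orbits _ _ (image^~ (gen2_mul Y%:R alpha)) _ _ Kh) => //.
- move=> _ [I FI <-]; rewrite gen2_class //.
  exists (gen2_mul Y%:R alpha I) => //.
  exact: (iter_gen2_fractional Oalpha Y_gt0 1 FI).
- move=> _ [I FI <-]; rewrite iter_gen2_class //.
  exact: (iter_gen2_class_n Oalpha Y_gt0 n_gt0 alpha_trace alpha_norm co_TY FI).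
- move=> _ k [I FI <-] k_dvd k_lt; rewrite iter_gen2_class //.
  exact: (iter_gen2_class_neq Oalpha Y_gt0 n_gt0 alpha_trace alpha_norm co_TY
            E_nsq E3_nsq n_odd Y_big qT FI k_dvd k_lt).
Qed.

Lemma class_number_gt0 h : has_class_number K h -> (0 < h)%N.
Proof.
case: h => // K0; have : class_group K = set0.
  by apply/eqP; move: K0; rewrite /has_class_number II0 card_eq0.
have FO : fractional_ideal K O.
  split.
  - by move=> x [].
  - exact: (Oint 0).
  - exact: OD.
  - exact: OM.
  - by exists 1; [exact: (Oint 1)|exact: oner_neq0].
  - by exists 1; split; [exact: (Oint 1)|exact: oner_neq0|move=> x; rewrite mul1r].
move=> C0; have : class_group K (ideal_class K O) by exists O.
by rewrite C0.
Qed.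

End ImaginaryQuadratic.

(** * Congruence criteria for non-squares *)

Lemma nonsquare_mod8 (a : nat) :
  (a %% 8)%N \in [:: 2; 3; 5; 6; 7]%N -> forall c, a <> (c ^ 2)%N.
Proof.
move=> a8 c ac; move: a8; rewrite ac -modnXm.
by have := ltn_pmod c (isT : (0 < 8)%N); case: (c %% 8)%N => [|[|[|[|[|[|[|[|]]]]]]]].
Qed.

Lemma nonsquare_3mul (a : nat) : ~~ (3 %| a)%N -> forall c, (3 * a)%N <> (c ^ 2)%N.
Proof.
move=> a3 c ac; case/negP: a3.
have /dvdnP[e ce] : (3 %| c)%N.
  by have := Euclid_dvdX c 2 (isT : prime 3); rewrite -ac dvdn_mulr // andbT => <-.
have /eqP : (3 * a = 3 * (3 * e ^ 2))%N by rewrite ac ce expnMn; ring.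
by rewrite eqn_pmul2l // => /eqP->; rewrite dvdn_mulr.
Qed.

(** * The quadruple attached to m = 4 y^n - 9 p^2 *)

Lemma modnX_odd8 (m n : nat) : (m %% 8 = 3)%N -> odd n -> (m ^ n %% 8 = 3)%N.
Proof.
move=> m8 n_odd; rewrite -(odd_double_half n) n_odd add1n -modnXm m8 -muln2 expnS mulnC.
elim: n./2 => [//|i IHi].
by rewrite mulSn expnD -mulnA -modnMmr IHi.
Qed.

Lemma quadruple_base (n p B : nat) : odd n -> prime p -> odd p ->
  exists m y, [/\ [/\ (B < y)%N, (B < m)%N & (m + 9 * p ^ 2 = 4 * y ^ n)%N],
    (m %% 8 = 3)%N, (m %% 3 = 1)%N, coprime (3 * p) y & coprime (4 * p) m].
Proof.
move=> n_odd p_pr p_odd; have n_gt0 := odd_gt0 n_odd; have p_gt0 := prime_gt0 p_pr.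
pose Q := (B + 9 * p ^ 2)%N.
(* This [y] is 1 modulo [6 p], hence odd and prime to [3 p], and it exceeds [B + 9 p^2], so that [m]
   exceeds [B]. *)
have [y yE] : {y | y = 1 + Q * 2 * (3 * p)}%N by eexists.
have y_gt : (Q < y)%N by rewrite yE add1n ltnS -mulnA leq_pmulr // !muln_gt0 p_gt0.
have y_odd : odd y by rewrite yE oddD !oddM andbF.
have [X XE] : {X | X = y ^ n}%N by eexists.
have X_ge : (y <= X)%N by rewrite XE -[leqLHS]expn1 leq_pexp2l // (leq_ltn_trans _ y_gt).
have X_odd : odd X by rewrite XE oddX y_odd orbT.
have X_mod3 : (X %% 3 = 1)%N.
  by rewrite XE -modnXm yE mulnCA mulnC addnC modnMDl exp1n.
have p2_mod8 : (p ^ 2 %% 8 = 1)%N.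
  rewrite -modnXm; have : odd (p %% 8) by rewrite odd_mod.
  by have := ltn_pmod p (isT : (0 < 8)%N); case: (p %% 8)%N => [|[|[|[|[|[|[|[|]]]]]]]].
have co_y : coprime (3 * p) y by rewrite yE addnC /coprime gcdnMDl gcdn1.
have [m mE] : {m | m = 4 * X - 9 * p ^ 2}%N by eexists.
have Q_le : (9 * p ^ 2 + B = Q)%N by rewrite addnC.
have p_m : ~~ (p %| m)%N.
  apply/negP => pm; have : (p %| 4 * X)%N.
    rewrite -(@subnK (9 * p ^ 2) (4 * X)) -?mE ?dvdn_add ?dvdn_mull ?dvdn_exp //.
    by move: (p ^ 2)%N Q_le => P *; lia.
  rewrite Euclid_dvdM // XE (Euclid_dvdX 2 2) // Euclid_dvdX // andbT dvdn_prime2 //.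
  case/orP=> [/eqP p2|/andP[py _]]; first by rewrite p2 in p_odd.
  by move: co_y; rewrite coprimeMl (prime_coprime y p_pr) py andbF.
(* With [p^2] and [y^n] abstracted, the remaining bounds and congruences are linear: [m = 4 - 9 = 3]
   modulo 8 and [m = 4 = 1] modulo 3. *)
move: (p ^ 2)%N Q_le mE p2_mod8 => P Q_le mE P_mod8.
exists m, y; split=> //.
- by rewrite -XE; split; lia.
- by lia.
- by lia.
rewrite coprimeMl (prime_coprime m p_pr) p_m andbT.
by apply: (@coprimeXl 2 2); rewrite coprime2n; lia.
Qed.

Lemma quadruple_exists (n p : nat) : odd n -> prime p -> odd p ->
  exists d : int, [/\ [/\ d < 0, d + 1 < 0, d + 4 < 0 & d + 4 * p%:Z ^+ 2 < 0],
    class_number_divisible_by (Qsqrt d) n,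
    class_number_divisible_by (Qsqrt (d + 1)) n,
    class_number_divisible_by (Qsqrt (d + 4)) n &
    class_number_divisible_by (Qsqrt (d + 4 * p%:Z ^+ 2)) n].
Proof.
move=> n_odd p_pr p_odd; have n_gt0 := odd_gt0 n_odd; have p_gt0 := prime_gt0 p_pr.
(* Large enough for [T + T^n] with every [T <= 4 p], and for [4 p^2 < M], which keeps all four
   radicands negative. *)
pose bound := (4 * p + (4 * p) ^ n + 4 * p ^ 2)%N.
have [m [y [[y_big m_big mE] m8 m3 co_y co_m]]] :=
  quadruple_base bound n_odd p_pr p_odd.
have m_gt0 : (0 < m)%N by exact: leq_ltn_trans m_big.
have [M M_E] : {M | M = m ^ n}%N by eexists.
have M_ge : (m <= M)%N by rewrite M_E -[leqLHS]expn1 leq_pexp2l.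
have M8 : (M %% 8 = 3)%N by rewrite M_E modnX_odd8.
have M3 : ~~ (3 %| M)%N by rewrite M_E Euclid_dvdX // /dvdn m3.
have p2_odd : odd (p ^ 2) by rewrite oddX p_odd.
have big_T T Z : (T <= 4 * p)%N -> (bound < Z)%N -> (T + T ^ n < Z)%N.
  move=> T_le; apply: leq_ltn_trans; rewrite (leq_trans _ (leq_addr _ _)) //.
  by rewrite leq_add // leq_exp2r.
have bound_ge : (4 * p + 4 * p ^ 2 <= bound)%N by rewrite /bound addnAC leq_addr.
have co_dvd T : (T %| 4 * p)%N -> coprime T m by move=> /coprime_dvdl; apply.
have MR : M%:R = m%:R ^+ n :> rat by rewrite M_E natrX.
have PE : p%:Z ^+ 2 = (p ^ 2)%N by rewrite -natrXE.
have PR : p%:R ^+ 2 = (p ^ 2)%N%:R :> rat by rewrite natrX.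
move: (p ^ 2)%N PE PR mE p2_odd bound_ge => P PE PR mE P_odd bound_ge.
exists (- M%:Z); rewrite PE; split.
- by split; lia.
(* As [n] is odd, [M] is [m] times a square; this [b] makes [b^2 M = m / 4], and the norm is
   [(9 p^2 + m) / 4 = y^n]. The valuation of [3 p] at 3 is 1, or 2 when [p = 3]. *)
- apply: (@class_number_divisible M _ n (3 * p) y 3 ((2 * m%:R ^+ n./2)^-1)) => //.
  + by lia.
  + by apply: nonsquare_mod8; rewrite M8.
  (* Here [3 M] is 1 modulo 8, so the argument must be made at the prime 3. *)
  + exact: nonsquare_3mul.
  + by apply: big_T => //; rewrite leq_mul2r orbT.
  + by rewrite lognM // !logn_prime //=; case: (3 == p).
  + have m0 : m%:R != 0 :> rat by rewrite pnatr_eq0 -lt0n.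
    have mX0 : m%:R ^+ n./2 != 0 :> rat by rewrite expf_neq0.
    have -> : M%:R = m%:R * (m%:R ^+ n./2) ^+ 2 :> rat.
      by rewrite MR -{1}(odd_double_half n) n_odd add1n exprS -muln2 exprM.
    have mR : m%:R + 9 * P%:R = 4 * y%:R ^+ n :> rat.
      by rewrite -natrX -!natrM -natrD mE.
    have -> : y%:R ^+ n = (m%:R + 9 * P%:R) / 4 :> rat by rewrite mR mulrC mulKf.
    by rewrite natrM -PR; field; rewrite mX0.
- have -> : - M%:Z + 1 = - (M - 1)%N%:Z by lia.
  (* In this field and the next two, [b = 1] and the norm equation is
     [(T/2)^2 + (m^n - (T/2)^2) = m^n]. *)
  apply: (@class_number_divisible (M - 1) _ n 2 m 2 1) => //.
  + by lia.
  + by apply: nonsquare_mod8; have -> : ((M - 1) %% 8 = 2)%N by lia.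
  + by apply: nonsquare_mod8; have -> : ((3 * (M - 1)) %% 8 = 6)%N by lia.
  + by apply: co_dvd; rewrite dvdn_mulr.
  + by apply: big_T => //; lia.
  + by rewrite divff // !expr1n mul1r -MR -(natrD _ 1%N) subnKC //; lia.
- have -> : - M%:Z + 4 = - (M - 4)%N%:Z by lia.
  apply: (@class_number_divisible (M - 4) _ n 4 m 2 1) => //.
  + by lia.
  + by apply: nonsquare_mod8; have -> : ((M - 4) %% 8 = 7)%N by lia.
  + by apply: nonsquare_mod8; have -> : ((3 * (M - 4)) %% 8 = 5)%N by lia.
  + by apply: co_dvd; rewrite dvdn_mulr.
  + by apply: big_T => //; lia.
  + have -> : (4 / 2) ^+ 2 = 4%:R :> rat by [].
    by rewrite expr1n mul1r -MR -natrD subnKC //; lia.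
- have -> : - M%:Z + 4 * P%:Z = - (M - 4 * P)%N%:Z by lia.
  apply: (@class_number_divisible (M - 4 * P) _ n (4 * p) m p 1) => //.
  + by lia.
  + by apply: nonsquare_mod8; have -> : ((M - 4 * P) %% 8 = 7)%N by lia.
  + by apply: nonsquare_mod8; have -> : ((3 * (M - 4 * P)) %% 8 = 5)%N by lia.
  + exact: big_T.
  + rewrite lognM // (logn_prime p p_pr) eqxx (@lognX p 2 2) logn_prime //.
    by case: eqP => // p2; rewrite p2 in p_odd.
  + have -> : ((4 * p)%N%:R / 2) ^+ 2 = (4 * P)%N%:R :> rat.
      by rewrite !natrM -PR; field.
    by rewrite expr1n mul1r -MR -natrD subnKC //; lia.
Qed.

(** * Infinitely many quadruples from unbounded class numbers *)

Theorem theorem1p1 (n p : nat) (n_odd : odd n) (p_prime : prime p)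
    (p_odd : odd p) :
  infinite_set
    [set F : set algC * set algC * set algC * set algC |
      exists d : int,
        [/\ F = (Qsqrt d, Qsqrt (d + 1), Qsqrt (d + 4),
                 Qsqrt (d + 4 * p%:Z ^+ 2)),
            [/\ d < 0, d + 1 < 0, d + 4 < 0 & d + 4 * p%:Z ^+ 2 < 0],
            class_number_divisible_by (Qsqrt d) n,
            class_number_divisible_by (Qsqrt (d + 1)) n &
            class_number_divisible_by (Qsqrt (d + 4)) n /\
            class_number_divisible_by (Qsqrt (d + 4 * p%:Z ^+ 2)) n]].
Proof.
(* The function [g] selects the class number of a field where one exists; its value elsewhere is
   irrelevant. *)
have /boolp.choice[g gP] (K : set algC) :
    exists h, (exists h', has_class_number K h') -> has_class_number K h.
  case: (pselect (exists h, has_class_number K h)) => [[h Kh]|noh]; first by exists h.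
  by exists 0%N.
move=> fin_quad.
pose first_field (F : set algC * set algC * set algC * set algC) := F.1.1.1.
have /finite_seqP[s sE] := finite_image (g \o first_field) fin_quad.
(* An odd multiple of [n] larger than every class number in [s]. A positive class number divisible
   by [N] cannot lie in [s]. *)
pose N := (n * (2 * (\max_(i <- s) i) + 1))%N.
have N_odd : odd N by rewrite oddM n_odd addn1 /= oddM.
have [d [d_neg h0 h1 h2 h3]] := quadruple_exists N_odd p_prime p_odd.
have div_n K : class_number_divisible_by K N -> class_number_divisible_by K n.
  by move=> [h Kh Nh]; exists h => //; apply: dvdn_trans Nh; exact: dvdn_mulr.
have [h Kh Nh] := h0.
have gh : g (Qsqrt d) = h.
  have gd := gP _ (ex_intro _ h Kh).
  by apply/card_eq_II; apply: card_eq_trans (card_esym gd) Kh.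
have h_gt0 : (0 < h)%N.
  have d_E : d = - `|d|%N%:Z by case: d_neg => d_lt0 _ _ _; lia.
  by move: Kh; rewrite d_E; apply: class_number_gt0; case: d_neg => d_lt0 _ _ _; lia.
have : h \in s.
  have : [set` s] h; last by [].
  rewrite -sE.
  exists (Qsqrt d, Qsqrt (d + 1), Qsqrt (d + 4), Qsqrt (d + 4 * p%:Z ^+ 2)) => //.
  by exists d; split; [by []|by []|exact: div_n|exact: div_n|split; exact: div_n].
move=> hs; have h_le : (h <= \max_(i <- s) i)%N by exact: (leq_bigmax_seq h hs).
have := dvdn_leq h_gt0 Nh; rewrite leqNgt => /negP; apply.
have n_gt0 := odd_gt0 n_odd.
by rewrite (leq_ltn_trans h_le) // /N; nia.
Qed.
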